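(* With the notation of the context, for $j=1,\dots,N$ we have $$\alpha(\xi_j(t))=\pi_0^{-(p-1)v_j}\,\frac{H(-v_j)}{[v_j']_{pv_j-v_j'}}\,\xi_j'(t).$$
   Context: For $z\in\mathbb{C}_p$, $l\in\mathbb{Z}$ put $[z]_0=1$; $[z]_l=\frac{1}{(z+1)\cdots(z+l)}$ if $l>0$ and $z\notin\{-1,\dots,-l\}$; $[z]_l=z(z-1)\cdots(z+l+1)$ if $l<0$. Also $(z)_l=z(z+1)\cdots(z+l-1)$ for $l\ge0$. $p$ is a prime; $\mathbb{C}_p$ is the completion of an algebraic closure of $\mathbb{Q}_p$ with norm $|\cdot|$ and valuation $\mathrm{ord}$, $\mathrm{ord}\,p=1$. $v_1,\dots,v_N$ are $p$-integral rational numbers in $[-1,0]$. For each $j$, $v_j'$ is the unique rational number in $[-1,0]$ with $pv_j-v_j'\in\{0,-1,\dots,-(p-1)\}$ (so $v_j'=-1$ if $v_j=-1$, $v_j'=0$ if $v_j=0$). $\pi_0\in\mathbb{C}_p$ is a root of $\sum_{i\ge0}t^{p^i}/p^i=0$ with $\mathrm{ord}\,\pi_0=1/(p-1)$. Fix a positive integer $d$ with $dv_j\in\mathbb{Z}$ for all $j$ and a $d$-th root of $\pi_0$, which defines $\pi_0^r$ for $r\in\frac1d\mathbb{Z}$. Define formal series $$\xi_j(t)=\begin{cases}\sum_{l=-\infty}^\infty[v_j]_l(\pi_0t)^{v_j+l}&\text{if }v_j>-1,\\ \sum_{l=0}^\infty(-1)^l\,l!\,(\pi_0t)^{-1-l}&\text{if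 }v_j=-1,\end{cases}$$ and let $\xi_j'(t)$ be the series obtained by replacing $v_j$ by $v_j'$. Let $C\{t\}$ be the space of formal series $\sum_{l\in\mathbb{Z}}c_lt^l$, $c_l\in\mathbb{C}_p$, with $|c_l|\delta^{|l|}\to0$ as $|l|\to\infty$ for every $0<\delta<1$, and $C^-\{t\}$ the subspace of series with $c_l=0$ for $l>0$. One has $\xi_j(t)\in t^{v_j}C\{t\}$, and $\xi_j(t)\in t^{-1}C^-\{t\}$ if $v_j=-1$. Let $\sigma(t)=\exp(\pi_0t-\pi_0t^p)=\sum_{i\ge0}\sigma_it^i$ (which converges on a disk of radius $>1$, so multiplication by $\sigma(t)$ acts on $t^{v_j'}C\{t\}$), let $\Phi$ be the map replacing $t$ by $t^p$, and let $\gamma(\sum_{l\in\mathbb{Z}}c_lt^l)=\sum_{l\le-1}c_lt^l$. The operator $\alpha$ is: for $-1<v_j\le0$, $\alpha=\sigma(t)\circ\Phi:t^{v_j}C\{t\}\to t^{v_j'}C\{t\}$; for $v_j=-1$, $\alpha=\gamma\circ\sigma(t)\circ\Phi:t^{-1}C^-\{t\}\to t^{-1}C^-\{t\}$ (where $\sigma(t)$ denotes multiplication by $\sigma(t)$). $H(z)=\sum_{l=0}^\infty(-1)^l(z)_l\,\sigma_{pl}\,\pi_0^{-l}$, which converges for $z\in\mathbb{Z}_p$. *)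

(* Defs.v *)
From HB Require Import structures.
From mathcomp Require Import all_boot all_order all_algebra.
From mathcomp Require Import all_classical all_reals all_analysis.

Set Implicit Arguments.
Unset Strict Implicit.
Unset Printing Implicit Defensive.

Import Order.TTheory GRing.Theory Num.Theory.
Import numFieldNormedType.Exports.

Local Open Scope classical_set_scope.
Local Open Scope ring_scope.

Definition padic_norm (R : realType) (p : nat) (x : rat) : R :=
  if x == 0 then 0
  else p%:R ^+ logn p `|denq x| / p%:R ^+ logn p `|numq x|.

Definition padic_integral (p : nat) (x : rat) : Prop := ~~ (p %| `|denq x|)%N.

Record is_nonarch_absval (R : realType) (K : fieldType) (nrm : K -> R) : Prop := {
  absval_ge0 : forall x, 0 <= nrm x;
  absval_eq0 : forall x, nrm x = 0 <-> x = 0;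
  absvalM : forall x y, nrm (x * y) = nrm x * nrm y;
  absvalD : forall x y, nrm (x + y) <= Num.max (nrm x) (nrm y)
}.

Definition is_limit (R : realType) (K : fieldType) (nrm : K -> R)
    (u : nat -> K) (s : K) : Prop :=
  (fun n => nrm (u n - s)) @ \oo --> (0 : R).

Definition is_complete (R : realType) (K : fieldType) (nrm : K -> R) : Prop :=
  forall u : nat -> K,
    (forall e : R, 0 < e -> exists M : nat, forall m n : nat,
       (M <= m)%N -> (M <= n)%N -> nrm (u m - u n) < e) ->
    exists s : K, is_limit nrm u s.

Record is_completion (R : realType) (F E : fieldType) (nF : F -> R)
    (nE : E -> R) (i : {rmorphism F -> E}) : Prop := {
  completion_absval : is_nonarch_absval nE;
  completion_isometry : forall x, nE (i x) = nF x;
  completion_complete : is_complete nE;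
  completion_dense : forall (y : E) (e : R), 0 < e ->
    exists x : F, nE (y - i x) < e
}.

(* The tower Q -> Q_p -> (algebraic closure of Q_p) -> C_p, given by the
   properties that determine it up to isometric isomorphism. *)
Record complex_padic (R : realType) (p : nat) := ComplexPadic {
  Qp : fieldType;
  normQp : Qp -> R;
  rat_Qp : {rmorphism rat -> Qp};
  Qp_completion : is_completion (padic_norm R p) normQp rat_Qp;
  Qpbar : closedFieldType;
  normQpbar : Qpbar -> R;
  Qp_Qpbar : {rmorphism Qp -> Qpbar};
  Qpbar_absval : is_nonarch_absval normQpbar;
  Qpbar_isometry : forall x, normQpbar (Qp_Qpbar x) = normQp x;
  Qpbar_algebraic : forall x : Qpbar, algebraicOver Qp_Qpbar x;
  Cp :> fieldType;
  normCp : Cp -> R;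
  Qpbar_Cp : {rmorphism Qpbar -> Cp};
  Cp_completion : is_completion normQpbar normCp Qpbar_Cp
}.

Section Series.
Context (R : realType) (p : nat) (C : complex_padic R p).

Local Notation "`| x |p" := (normCp x) (format "`| x |p").

Definition ordp (x : C) : \bar R :=
  if x == 0 then +oo%E else (- ln `|x|p / ln p%:R)%:E.

Definition partial_sums (u : nat -> C) : nat -> C :=
  fun n => \sum_(0 <= i < n) u i.

Definition summable_to (u : nat -> C) (s : C) : Prop :=
  is_limit (@normCp R p C) (partial_sums u) s.

Definition series_converges (u : nat -> C) : Prop := exists s : C, summable_to u s.

(* The sum of a series, with the junk value 0 if the series diverges. *)
Definition infsum (u : nat -> C) : C := xget 0 [set s | summable_to u s].

(* [z]_l; for l > 0 it is meaningful only if z is not one of -1, ..., -l. *)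
Definition bracket (z : C) (l : int) : C :=
  match l with
  | Posz n => (\prod_(1 <= i < n.+1) (z + i%:R))^-1
  | Negz n => \prod_(0 <= i < n.+1) (z - i%:R)
  end.

Definition pochhammer (z : C) (l : nat) : C := \prod_(0 <= i < l) (z + i%:R).

(* Coefficient of t^i in exp(pi0 t - pi0 t^p); the powers of the argument of
   exponent > i do not contribute, as its constant term is 0. *)
Definition sigma (pi0 : C) (i : nat) : C :=
  (\sum_(0 <= n < i.+1)
     n`!%:R^-1 *: (pi0 *: 'X - pi0 *: 'X^p) ^+ n : {poly C})`_i.

Definition Hterm (pi0 z : C) (l : nat) : C :=
  (-1) ^+ l * pochhammer z l * sigma pi0 (p * l) * pi0 ^- l.

Definition Hfun (pi0 z : C) : C := infsum (Hterm pi0 z).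

(* pi0 ^ r for r in (1/d) Z, where rho is the chosen d-th root of pi0; then
   d * r is an integer, equal to its numerator. *)
Definition ratpow (d : nat) (rho : C) (r : rat) : C := rho ^ numq (d%:R * r).

(* A formal series in rational powers of t: f r is the coefficient of t^r. *)
Definition fseries := rat -> C.

Definition scale_series (a : C) (f : fseries) : fseries := fun r => a * f r.

(* t^v * (sum_l c_l t^l); an integer rational is equal to its numerator. *)
Definition tshift (v : rat) (c : int -> C) : fseries :=
  fun r => if r - v \is a Num.int then c (numq (r - v)) else 0.

Definition Cbrace : set (int -> C) :=
  [set c | forall delta : R, 0 < delta -> delta < 1 ->
     ((fun n : nat => `|c n%:Z|p * delta ^+ n) @ \oo --> (0 : R)) /\
     ((fun n : nat => `|c (- n%:Z)|p * delta ^+ n) @ \oo --> (0 : R))].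

Definition Cbrace_minus : set (int -> C) :=
  [set c | Cbrace c /\ forall l : int, 0 < l -> c l = 0].

(* The space t^v C{t} (t^(-1) C^-{t} if v = -1) on which alpha is defined;
   alpha itself is written below on all formal series, its value being
   meaningful when the series in mul_sigma converge. *)
Definition alpha_domain (v : rat) : set fseries :=
  if v == -1 then tshift v @` Cbrace_minus else tshift v @` Cbrace.

Definition Phi (f : fseries) : fseries := fun r => f (r / p%:R).

Definition mul_sigma_term (pi0 : C) (f : fseries) (r : rat) (i : nat) : C :=
  sigma pi0 i * f (r - i%:R).

Definition mul_sigma (pi0 : C) (f : fseries) : fseries :=
  fun r => infsum (mul_sigma_term pi0 f r).

Definition gamma_trunc (f : fseries) : fseries :=
  fun r => if r <= -1 then f r else 0.

Definition alpha (pi0 : C) (v : rat) (f : fseries) : fseries :=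
  if v == -1 then gamma_trunc (mul_sigma pi0 (Phi f))
  else mul_sigma pi0 (Phi f).

(* For v = -1 the sum over l >= 0 is reindexed by k = - l, so that its general
   term is the coefficient of t^(-1 + k). *)
Definition xi (d : nat) (rho : C) (v : rat) : fseries :=
  if v == -1 then
    tshift (-1) (fun k : int =>
      if k <= 0 then (-1) ^+ `|k|%N * (`|k|%N)`!%:R * ratpow d rho (-1 + k%:~R)
      else 0)
  else
    tshift v (fun l : int => bracket (ratr v) l * ratpow d rho (v + l%:~R)).

End Series.

Arguments alpha_domain {R p} C v.

(* Main.v *)
Require Import Defs.
From HB Require Import structures.
From mathcomp Require Import all_boot all_order all_algebra.
From mathcomp Require Import all_classical all_reals all_analysis.
From mathcomp Require Import zify ring lra.

(** Each [xi_j] is a formal solution of [t d/dt xi = pi0 t xi] (up to a constant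
    when [v_j = -1]).  As [t d/dt sigma = (pi0 t - p pi0 t^p) sigma], the series
    [alpha (xi_j)] solves the same equation, i.e. its coefficients satisfy
    [r g(r) = pi0 g(r - 1)], so it is determined by one coefficient.  The one of
    [t^(p v_j)] is [pi0^(v_j) H(- v_j)].

    Convergence needs two estimates.  The coefficients of [xi_j] grow at most
    polynomially, because [n!] and the products in arithmetic progressions
    [c (c + b) (c + 2 b) ...] with [p] prime to [b] have the [p]-adic size of
    [pi0 ^ n] up to a polynomial factor.  The coefficients of [sigma] decay
    geometrically: modulo [p], the linear recurrence satisfied by
    [n! sigma_n / pi0 ^ n] sends every initial state to [0] in [2 p] steps, by
    Wilson's theorem.  This makes the integrality of the Artin-Hasse exponential
    unnecessary. *)

Set Implicit Arguments.
Unset Strict Implicit.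
Unset Printing Implicit Defensive.

Import Order.TTheory GRing.Theory Num.Theory.
Import numFieldNormedType.Exports.

Local Open Scope classical_set_scope.
Local Open Scope ring_scope.

(** * Divisibility of products in arithmetic progressions *)

Definition arith_prod (c b l : nat) : nat := (\prod_(i < l) (c + b * i))%N.

Lemma arith_prodS c b l :
  arith_prod c b l.+1 = (arith_prod c b l * (c + b * l))%N.
Proof. by rewrite /arith_prod big_ord_recr. Qed.

Lemma arith_prod_gt0 c b l : (0 < c)%N -> (0 < arith_prod c b l)%N.
Proof. by move=> c0; apply: prodn_gt0 => i; rewrite addn_gt0 c0. Qed.

Lemma arith_prod_ffact x l : arith_prod x.+1 1 l = ((x + l) ^_ l)%N.
Proof.
elim: l => [|l IHl]; first by rewrite /arith_prod big_ord0 ffactn0.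
by rewrite arith_prodS IHl addnS ffactSS mul1n mulnC addSn.
Qed.

(** As b is invertible modulo p ^ M, the product is congruent to b ^ l times a product of l
    consecutive integers, which is l! times a binomial coefficient. *)
Lemma fact_dvd_arith_prod p c b l : prime p -> coprime p b ->
  (p ^ logn p l`! %| arith_prod c b l)%N.
Proof.
move=> p_pr cpb; set M := logn p l`!; set q := (p ^ M)%N.
have q0 : (0 < q)%N by rewrite expn_gt0 prime_gt0.
have b0 : (0 < b)%N.
  by case: b cpb => // /eqP; rewrite gcdn0 => p1; rewrite p1 in p_pr.
have cqb : coprime q b by rewrite coprimeXl.
have [u uq] : exists u, (b * u = 1 %[mod q])%N.
  case: (egcdnP q b0) => u k; rewrite gcdnC (eqP cqb) => E _.
  by exists u; rewrite mulnC E modnMDl.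
(* Adding q keeps the class modulo q and makes the predecessor legitimate. *)
pose x := (c * u + q).-1.
have xE : x.+1 = (c * u + q)%N by rewrite prednK // addn_gt0 q0 orbT.
have E : (arith_prod c b l = b ^ l * arith_prod x.+1 1 l %[mod q])%N.
  elim: (l) => [|k IHk]; first by rewrite /arith_prod !big_ord0.
  rewrite !arith_prodS -modnMm IHk expnSr mulnACA -[in RHS]modnMm.
  congr ((_ * _) %% _)%N; rewrite xE mul1n mulnDr -[in RHS]modnDml.
  rewrite mulnDr -[in RHS](modnDmr (b * _)) modnMl addn0 mulnCA -modnMmr uq.
  by rewrite modnMmr muln1 modnDml.
rewrite /dvdn E -/(dvdn _ _) dvdn_mull// arith_prod_ffact -bin_ffact.
by rewrite dvdn_mull// pfactor_dvdnn.
Qed.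

(** The factors 1, ..., b l are sorted by residue class modulo b. *)
Lemma fact_arith_prod b l : (b * l)`! = (\prod_(c < b) arith_prod c.+1 b l)%N.
Proof.
rewrite /arith_prod exchange_big/=; elim: l => [|l IHl].
  by rewrite muln0 big_ord0.
rewrite big_ord_recr/= -IHl mulnS addnC.
suff H k m : ((m + k)`! = m`! * \prod_(i < k) (i.+1 + m))%N by apply: H.
elim: k => [|k IHk]; first by rewrite big_ord0 muln1 addn0.
by rewrite big_ord_recr/= addnS factS IHk mulnC addSn addnC mulnA.
Qed.

(** Each block of p consecutive factors consists of its last one, p (l + 1), and of factors prime to
    p. *)
Lemma logn_factM p l : prime p -> logn p (p * l)`! = (l + logn p l`!)%N.
Proof.
move=> p_pr; have p0 := prime_gt0 p_pr.
elim: l => [|l IHl]; first by rewrite muln0.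
have : (p * l + p)`! = ((p * l)`! * ((p * l.+1) * (p * l + p.-1) ^_ p.-1))%N.
  rewrite -[in LHS](prednK p0) addnS factS -addnS prednK// -mulnSr.
  rewrite -(@ffact_fact (p * l + p.-1) p.-1) ?leq_addl// addnK.
  by rewrite mulnC -mulnA mulnC -mulnA.
rewrite -mulnSr => ->.
have cop : coprime p ((p * l + p.-1) ^_ p.-1).
  rewrite ffact_prod; apply: (big_ind (fun x => coprime p x)) => [||i _].
  - exact: coprimen1.
  - by move=> x y; rewrite coprimeMr => -> ->.
  - rewrite -addnBA; last exact: ltnW.
    rewrite prime_coprime// dvdn_addr ?dvdn_mulr//.
    by apply/negP => /dvdn_leq; have := ltn_ord i; lia.
have c0 : (0 < (p * l + p.-1) ^_ p.-1)%N by rewrite ffact_gt0 leq_addl.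
rewrite [l.+1`!]factS !lognM ?fact_gt0 ?muln_gt0 ?p0// IHl (logn_coprime cop) (logn_prime p p_pr).
by rewrite eqxx addn0 add1n addnS addSn addnAC -addnA.
Qed.

Lemma logn_fact_divn p l : prime p ->
  logn p l`! = (l %/ p + logn p (l %/ p)`!)%N.
Proof.
move=> p_pr; rewrite -logn_factM//; have p0 := prime_gt0 p_pr.
rewrite {1}(divn_eq l p) (mulnC _ p).
elim: (l %% p)%N {-2}(l %% p)%N (leqnn (l %% p)) (ltn_pmod l p0) => [|k IHk] [|r] // rk rp.
- by rewrite addn0.
- by rewrite addn0.
rewrite addnS factS lognM ?fact_gt0// IHk ?ltnS// 1?ltnW//.
rewrite logn_coprime// prime_coprime// -addnS dvdn_addr ?dvdn_mulr//.
by apply/negP => /dvdn_leq; lia.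
Qed.

Lemma logn_fact_le p l : prime p -> (p.-1 * logn p l`! <= l)%N.
Proof.
move=> p_pr; have p1 := prime_gt1 p_pr.
elim/ltn_ind: l => -[|l] IHl; first by rewrite fact0 logn1 muln0.
rewrite logn_fact_divn//.
have := IHl (l.+1 %/ p)%N (ltn_Pdiv p1 (ltn0Sn l)).
have := leq_trunc_div l.+1 p; case: p {p_pr} p1 IHl => // p _ _ /=; nia.
Qed.

(** By Legendre, (p - 1) ord l! is l minus the sum of the base p digits of l. Each digit costs at
    most p - 1, and T counts the digits. *)
Lemma logn_fact_ge p l : prime p ->
  exists2 T, (p ^ T <= p * l.+1)%N & (l <= p.-1 * (logn p l`! + T))%N.
Proof.
move=> p_pr; have p1 := prime_gt1 p_pr.
(* The sharper bound p * l for l > 0, with T = 0 at l = 0, is the one that passes from l %/ p to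
   l. *)
suff [T pT lT] : exists2 T, (l = 0%N /\ T = 0%N \/ p ^ T <= p * l)%N &
    (l <= p.-1 * (logn p l`! + T))%N.
  exists T => //; case: pT => [[-> ->]|/leq_trans]; first by rewrite expn0 muln1 ltnW.
  by apply; rewrite leq_mul.
elim/ltn_ind: l => -[|l] IHl; first by exists 0%N; [left|].
have [T pT lT] := IHl (l.+1 %/ p)%N (ltn_Pdiv p1 (ltn0Sn l)).
exists T.+1; last first.
  rewrite logn_fact_divn//; move: lT (ltn_ceil l.+1 (ltnW p1)).
  case: p {p_pr IHl pT} p1 => // p _ /=; nia.
right; rewrite expnS leq_mul2l; apply/orP; right; case: pT => [[_ ->]//|].
by move/leq_trans; apply; rewrite mulnC leq_trunc_div.
Qed.

(** Each of the other b - 1 progressions in [fact_arith_prod] takes at least the valuation of l!;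
    what remains bounds this one. *)
Lemma logn_arith_prod_le p c b l : prime p -> (0 < c <= b)%N -> coprime p b ->
  (logn p (arith_prod c b l) + b.-1 * logn p l`! <= logn p (b * l)`!)%N.
Proof.
move=> p_pr /andP[c0 cb] cpb; rewrite fact_arith_prod.
rewrite (_ : logn p (\prod_(i < b) _) = \sum_(i < b) logn p (arith_prod i.+1 b l))%N; last first.
  suff H k : (logn p (\prod_(i < k) arith_prod i.+1 b l) =
      \sum_(i < k) logn p (arith_prod i.+1 b l))%N by apply: H.
  elim: k => [|k IHk]; first by rewrite !big_ord0 logn1.
  rewrite !big_ord_recr/= lognM ?arith_prod_gt0// ?IHk//.
  by apply: prodn_gt0 => i; rewrite arith_prod_gt0.
have cb' : (c.-1 < b)%N by rewrite prednK.
rewrite (bigD1 (Ordinal cb'))//= prednK// leq_add2l.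
rewrite (_ : b.-1 = #|[pred i : 'I_b | i != Ordinal cb']|); last first.
  by rewrite cardC1 card_ord.
rewrite -sum_nat_const; apply: leq_sum => i _.
by rewrite -pfactor_dvdn// ?arith_prod_gt0// fact_dvd_arith_prod.
Qed.

(** * Growth of sequences and non-archimedean limits *)

Section PolynomialGrowth.
Variable R : realType.
Implicit Types (t : R) (k n : nat).

(** With t = s ^ 2, one factor s ^ n pays for one n + 1, the other for the remaining power by
    induction. *)
Lemma poly_geom_bounded t k : 0 <= t -> t < 1 ->
  exists2 M : R, 0 <= M & forall n, n.+1%:R ^+ k * t ^+ n <= M.
Proof.
elim: k t => [|k IHk] t t0 t1.
  by exists 1 => // n; rewrite expr0 mul1r exprn_ile1// ltW.
have [s0 s1] : 0 <= Num.sqrt t /\ Num.sqrt t < 1.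
  by rewrite sqrtr_ge0 -sqrtr1 ltr_sqrt.
move: (Num.sqrt t) s0 s1 (sqr_sqrtr t0) => {t0 t1} s s0 s1 <-{t}.
have [M M0 hM] := IHk s s0 s1.
have linear n : n.+1%:R * s ^+ n <= (1 - s)^-1.
  rewrite -[leRHS]mul1r ler_pdivlMr ?subr_gt0//.
  (* Each of the n + 1 terms of 1 + s + ... + s ^ n is at least s ^ n. *)
  suff : n.+1%:R * s ^+ n * (1 - s) <= 1 - s ^+ n.+1.
    by move/le_trans; apply; rewrite gerBl exprn_ge0.
  elim: n => [|n IHn]; first by rewrite expr0 expr1 !mul1r.
  have y1 : s ^+ n.+1 <= 1 by rewrite exprn_ile1// ltW.
  have y2 : 0 <= (1 - s) * (1 - s ^+ n.+1) by rewrite mulr_ge0 ?subr_ge0 ?(ltW s1).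
  have y3 := ler_wpM2l s0 IHn.
  have e2 : s ^+ n.+2 = s * s ^+ n.+1 by rewrite exprS.
  have e1 : s ^+ n.+1 = s * s ^+ n by rewrite exprS.
  rewrite e2 -[n.+2%:R]natr1; move: y1 y2 y3; rewrite e1 -[n.+1%:R]natr1.
  move: (s ^+ n) (n%:R : R) => x m; nra.
exists (M * (1 - s)^-1) => [|n]; first by rewrite mulr_ge0// invr_ge0 subr_ge0 ltW.
rewrite exprSr -exprM mulnC exprM expr2 mulrACA ler_pM ?mulr_ge0 ?exprn_ge0//.
Qed.

Lemma poly_geom_cvg0 t k : 0 <= t -> t < 1 ->
  n.+1%:R ^+ k * t ^+ n @[n --> \oo] --> (0 : R).
Proof.
move=> t0 t1; have [s0 s1] : 0 <= Num.sqrt t /\ Num.sqrt t < 1.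
  by rewrite sqrtr_ge0 -sqrtr1 ltr_sqrt.
have [M M0 hM] := poly_geom_bounded k s0 s1.
apply: (@squeeze_cvgr _ _ _ _ (cst 0) (fun n => M * Num.sqrt t ^+ n)).
- apply: nearW => n; rewrite mulr_ge0 ?exprn_ge0//=.
  rewrite -{1}(sqr_sqrtr t0) -exprM mulnC exprM expr2 mulrA.
  by rewrite ler_wpM2r ?exprn_ge0.
- exact: cvg_cst.
- by rewrite -(mulr0 M); apply: cvgMr; apply: cvg_expr; rewrite ger0_norm.
Qed.

Lemma cvg0_le_poly_geom (u : nat -> R) (M t : R) k : 0 <= t -> t < 1 ->
    (forall n, 0 <= u n) -> (forall n, u n <= M * (n.+1%:R ^+ k * t ^+ n)) ->
  u n @[n --> \oo] --> (0 : R).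
Proof.
move=> t0 t1 u0 uM; apply: (@squeeze_cvgr _ _ _ _ (cst 0) _ u _ 0 (cvg_cst _)).
  by apply: nearW => n; rewrite u0/=; apply: uM.
by rewrite -(mulr0 M); apply: cvgMr; apply: poly_geom_cvg0.
Qed.

Lemma nonneg_cvg0P (u : nat -> R) : (forall n, 0 <= u n) ->
  u n @[n --> \oo] --> (0 : R) <->
  forall e, 0 < e -> exists M, forall n, (M <= n)%N -> u n < e.
Proof.
move=> u0; split=> [/cvgrPdist_lt cu e /cu[M _ hM]|cu].
  by exists M => n /hM/=; rewrite sub0r normrN ger0_norm.
apply/cvgrPdist_lt => e /cu[M hM]; exists M => // n /hM/=.
by rewrite sub0r normrN ger0_norm.
Qed.

End PolynomialGrowth.

Section NonArchimedean.
Variables (R : realType) (K : fieldType) (nrm : K -> R).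
Hypothesis nrmP : is_nonarch_absval nrm.
Implicit Types (x y : K) (u : nat -> K).

Let nrm_ge0 x : 0 <= nrm x := absval_ge0 nrmP x.

Lemma absval0 : nrm 0 = 0.
Proof. exact/(absval_eq0 nrmP). Qed.

Lemma absval_gt0 x : x != 0 -> 0 < nrm x.
Proof.
by move=> x0; rewrite lt_neqAle nrm_ge0 andbT eq_sym; apply: contra_neq x0 => /(absval_eq0 nrmP).
Qed.

Lemma absval1 : nrm 1 = 1.
Proof.
have n1 : nrm 1 != 0 by rewrite gt_eqF// absval_gt0 ?oner_neq0.
by apply: (mulfI n1); rewrite -(absvalM nrmP) !mulr1.
Qed.

Lemma absvalN x : nrm (- x) = nrm x.
Proof.
suff h y : nrm (- y) <= nrm y by apply/le_anti; rewrite h -{1}(opprK x) h.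
have h1 : nrm (-1) = 1.
  apply/eqP; rewrite -(@eqrXn2 _ 2)// expr1n expr2 -(absvalM nrmP).
  by rewrite mulrNN mulr1 absval1.
by rewrite -mulN1r (absvalM nrmP) h1 mul1r.
Qed.

Lemma absvalX x n : nrm (x ^+ n) = nrm x ^+ n.
Proof. by elim: n => [|n IHn]; rewrite ?absval1// !exprS (absvalM nrmP) IHn. Qed.

Lemma absvalV x : nrm x^-1 = (nrm x)^-1.
Proof.
have [->|x0] := eqVneq x 0; first by rewrite invr0 absval0 invr0.
have n0 : nrm x != 0 by rewrite gt_eqF// absval_gt0.
by apply: (mulfI n0); rewrite -(absvalM nrmP) !divff// absval1.
Qed.

Lemma absval_prod n (F : nat -> K) :
  nrm (\prod_(0 <= i < n) F i) = \prod_(0 <= i < n) nrm (F i).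
Proof.
elim: n => [|n IHn]; first by rewrite !big_geq// absval1.
by rewrite !big_nat_recr//= (absvalM nrmP) IHn.
Qed.

Lemma absvalD_le x y B : nrm x <= B -> nrm y <= B -> nrm (x + y) <= B.
Proof. by move=> xB yB; apply: le_trans (absvalD nrmP x y) _; rewrite ge_max xB. Qed.

Lemma absvalB_le x y B : nrm x <= B -> nrm y <= B -> nrm (x - y) <= B.
Proof. by move=> xB yB; rewrite absvalD_le// absvalN. Qed.

Lemma absvalB_lt x y B : nrm x < B -> nrm y < B -> nrm (x - y) < B.
Proof.
by move=> xB yB; apply: le_lt_trans (absvalD nrmP x _) _; rewrite absvalN gt_max xB.
Qed.

Lemma absval_sum_le m n u B : 0 <= B ->
    (forall i, (m <= i < n)%N -> nrm (u i) <= B) ->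
  nrm (\sum_(m <= i < n) u i) <= B.
Proof.
move=> B0 uB; rewrite big_seq; apply: (big_ind (fun x => nrm x <= B)).
- by rewrite absval0.
- by move=> x y xB yB; apply: absvalD_le.
- by move=> i; rewrite mem_index_iota; apply: uB.
Qed.

Lemma absval_nat_le1 n : nrm n%:R <= 1.
Proof. by elim: n => [|n IHn]; rewrite ?absval0// -natr1 absvalD_le// absval1. Qed.

Lemma is_limitP u s : is_limit nrm u s <->
  forall e, 0 < e -> exists M, forall n, (M <= n)%N -> nrm (u n - s) < e.
Proof. exact: nonneg_cvg0P. Qed.

Lemma is_limit_unique u s t : is_limit nrm u s -> is_limit nrm u t -> s = t.
Proof.
move=> /is_limitP us /is_limitP ut; apply/eqP; rewrite -subr_eq0; apply/eqP.
apply/(absval_eq0 nrmP); apply/eqP; apply: contraT => st.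
have e0 : 0 < nrm (s - t) by rewrite lt_neqAle nrm_ge0 eq_sym st.
have [M hM] := us _ e0; have [N hN] := ut _ e0.
have := absvalB_lt (hN _ (leq_maxr M N)) (hM _ (leq_maxl M N)).
by rewrite opprB addrC addrA subrK ltxx.
Qed.

Lemma is_limitD u u' s s' : is_limit nrm u s -> is_limit nrm u' s' ->
  is_limit nrm (fun n => u n + u' n) (s + s').
Proof.
move=> /is_limitP us /is_limitP us'; apply/is_limitP => e e0.
have [M hM] := us _ e0; have [N hN] := us' _ e0; exists (maxn M N) => n.
rewrite geq_max => /andP[/hM Mn /hN Nn]; rewrite opprD addrACA.
by apply: le_lt_trans (absvalD nrmP _ _) _; rewrite gt_max Mn.
Qed.

Lemma is_limitZ c u s : is_limit nrm u s -> is_limit nrm (fun n => c * u n) (c * s).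
Proof.
move=> us; rewrite /is_limit.
under eq_fun do rewrite -mulrBr (absvalM nrmP).
by rewrite -(mulr0 (nrm c)); apply: cvgMr.
Qed.

Lemma is_limit_subseq u (f : nat -> nat) s : (forall n, (n <= f n)%N) ->
  is_limit nrm u s -> is_limit nrm (fun n => u (f n)) s.
Proof.
move=> fn /is_limitP us; apply/is_limitP => e /us[M hM]; exists M => n Mn.
by apply: hM; apply: leq_trans (fn n).
Qed.

Lemma is_limit_shift k u s :
  is_limit nrm (fun n => u (n + k)%N) s -> is_limit nrm u s.
Proof.
move=> /is_limitP us; apply/is_limitP => e /us[M hM]; exists (M + k)%N => n Mn.
by rewrite -(subnK (leq_trans (leq_addl M k) Mn)) hM// leq_subRL ?(leq_trans (leq_addl M k))// addnC.
Qed.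

End NonArchimedean.

(** * Series in C_p and the recurrence of sigma *)

Section PadicField.
Variables (R : realType) (p : nat) (C : complex_padic R p).

Local Notation "`| x |p" := (normCp x) (format "`| x |p").

Lemma normCp_absval : is_nonarch_absval (@normCp R p C).
Proof. exact: completion_absval (Cp_completion C). Qed.

(** A morphism out of [rat] is unique, so [ratr] is this composite: it inherits the ring laws from
    it, and its norm from the isometries of the tower. *)
Definition rat_Cp : {rmorphism rat -> C} :=
  [the {rmorphism rat -> C} of @Qpbar_Cp R p C \o (@Qp_Qpbar R p C \o @rat_Qp R p C)].

Lemma ratr_Cp x : ratr x = rat_Cp x.
Proof. by rewrite fmorph_eq_rat. Qed.

Lemma normCp_ratr x : `|ratr x : C|p = padic_norm R p x.
Proof.
rewrite ratr_Cp /rat_Cp/= (completion_isometry (Cp_completion C)).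
by rewrite Qpbar_isometry (completion_isometry (Qp_completion C)).
Qed.

Lemma ratr_Cp_nat n : ratr n%:R = n%:R :> C.
Proof. by rewrite ratr_Cp rmorph_nat. Qed.

Lemma ratr_CpN x : ratr (- x) = - ratr x :> C.
Proof. by rewrite !ratr_Cp rmorphN. Qed.

Lemma ratr_CpD x y : ratr (x + y) = ratr x + ratr y :> C.
Proof. by rewrite !ratr_Cp rmorphD. Qed.

Lemma ratr_CpM x y : ratr (x * y) = ratr x * ratr y :> C.
Proof. by rewrite !ratr_Cp rmorphM. Qed.

Lemma ratr_Cp_eq0 x : (ratr x == 0 :> C) = (x == 0).
Proof. by rewrite ratr_Cp fmorph_eq0. Qed.

Lemma natCp_eq0 n : (n%:R == 0 :> C) = (n == 0%N).
Proof. by rewrite -ratr_Cp_nat ratr_Cp_eq0 pnatr_eq0. Qed.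

Lemma normCp_nat n : (0 < n)%N -> `|n%:R : C|p = p%:R^-1 ^+ logn p n.
Proof.
move=> n0; rewrite -ratr_Cp_nat normCp_ratr /padic_norm pnatr_eq0 gtn_eqF//.
rewrite (_ : n%:R = (n : int)%:~R :> rat)// numq_int denq_int/= logn1 expr0 mul1r exprVn//.
Qed.

(** By the ultrametric inequality a difference of partial sums is at most its largest term, so the
    partial sums are Cauchy. *)
Lemma null_series_converges (u : nat -> C) :
  is_limit (@normCp R p C) u 0 -> series_converges u.
Proof.
move=> /(is_limitP normCp_absval) u0.
apply: (completion_complete (Cp_completion C)) => e e0.
have [M hM] := u0 (e / 2) (divr_gt0 e0 (ltr0Sn _ _)).
have h m n : (M <= m)%N -> (m <= n)%N ->
    `|partial_sums u n - partial_sums u m|p < e.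
  move=> Mm mn; rewrite /partial_sums (big_cat_nat (leq0n m) mn)/=.
  rewrite addrAC subrr add0r; apply: (@le_lt_trans _ _ (e / 2)); last by lra.
  apply: (absval_sum_le normCp_absval); first lra.
  by move=> i /andP[mi _]; have := hM i (leq_trans Mm mi); rewrite subr0 => /ltW.
exists M => m n Mm Mn; case/orP: (leq_total m n) => mn; last exact: h.
by rewrite -(absvalN normCp_absval) opprB h.
Qed.

Lemma summable_infsum (u : nat -> C) s : summable_to u s -> infsum u = s.
Proof.
move=> us; apply: (is_limit_unique normCp_absval _ us).
have : exists t, [set t | summable_to u t] t by exists s.
exact: xgetPex.
Qed.

Lemma infsumP (u : nat -> C) : series_converges u -> summable_to u (infsum u).
Proof. by case=> s us; rewrite (summable_infsum us). Qed.

Lemma summableD (u u' : nat -> C) s s' : summable_to u s -> summable_to u' s' ->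
  summable_to (fun i => u i + u' i) (s + s').
Proof.
move=> us us'; rewrite /summable_to.
rewrite (_ : partial_sums _ = fun n => partial_sums u n + partial_sums u' n).
  exact: (is_limitD normCp_absval).
by apply/funext => n; rewrite /partial_sums big_split.
Qed.

Lemma summableZ c (u : nat -> C) s : summable_to u s ->
  summable_to (fun i => c * u i) (c * s).
Proof.
move=> us; rewrite /summable_to.
rewrite (_ : partial_sums _ = fun n => c * partial_sums u n).
  exact: (is_limitZ normCp_absval).
by apply/funext => n; rewrite /partial_sums mulr_sumr.
Qed.

(** Padding with k zeros brings the series for t ^ k times a product to the same summation index as
    the product itself. *)
Lemma summable_shift k (u : nat -> C) s : summable_to u s ->
  summable_to (fun i => if (i < k)%N then 0 else u (i - k)%N) s.
Proof.
move=> us; apply: (is_limit_shift normCp_absval (k := k)).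
rewrite (_ : (fun n => _) = partial_sums u)//; apply/funext => n.
rewrite /partial_sums (big_cat_nat (leq0n k) (leq_addl n k))/=.
rewrite big_nat big1 ?add0r; last by move=> i /andP[_ ->].
rewrite -{1}(add0n k) big_addn addnK; apply: eq_bigr => i _.
by rewrite ltnNge leq_addl/= addnK.
Qed.

Lemma summable0 (u : nat -> C) : (forall i, u i = 0) -> summable_to u 0.
Proof.
move=> u0; apply/(is_limitP normCp_absval) => e e0; exists 0%N => n _.
by rewrite /partial_sums big1// subrr absval0//; apply: normCp_absval.
Qed.

Lemma summable_multiples k (u : nat -> C) s : (0 < k)%N ->
    (forall i, ~~ (k %| i)%N -> u i = 0) ->
  summable_to u s -> summable_to (fun l => u (k * l)%N) s.
Proof.
move=> k0 uk us; rewrite /summable_to.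
rewrite (_ : partial_sums _ = fun n => partial_sums u (n * k)%N).
  apply: (is_limit_subseq normCp_absval (f := muln^~ k)) us => n.
  by rewrite leq_pmulr.
apply/funext => n; rewrite /partial_sums big_nat_mul; apply: eq_bigr => i _.
rewrite big_ltn ?ltn_mul2r ?k0//= big_nat big1 ?addr0 => [|j jk].
  by rewrite mulnC.
apply: uk; apply/negP => /dvdnP[m jE]; move: jk; rewrite jE !ltn_mul2r k0/=; lia.
Qed.

(** The argument of the exponential is divisible by 'X, so its powers beyond the i-th do not reach
    degree i. *)
Lemma sigma_coef pi0 N i : prime p -> (i <= N)%N ->
  (\sum_(0 <= n < N.+1)
     n`!%:R^-1 *: (pi0 *: 'X - pi0 *: 'X^p) ^+ n : {poly C})`_i = sigma pi0 i.
Proof.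
move=> hp; elim: N => [|N IHN]; first by rewrite leqn0 => /eqP ->.
rewrite leq_eqVlt => /predU1P[->//|iN]; rewrite big_nat_recr//= coefD IHN//.
have -> : pi0 *: 'X - pi0 *: 'X^p = 'X * (pi0 *: (1 - 'X^(p.-1))) :> {poly C}.
  by rewrite -scalerAr mulrBr mulr1 -exprS prednK ?prime_gt0// scalerBr.
by rewrite coefZ exprMn coefXnM iN mulr0 addr0.
Qed.

Lemma sigma0 pi0 : sigma pi0 0 = 1 :> C.
Proof. by rewrite /sigma big_nat1 fact0 invr1 scale1r expr0 coef1. Qed.

(** This is the coefficient of t ^ i in sigma' = (pi0 - p pi0 t ^ (p - 1)) sigma. *)
Lemma sigma_rec pi0 i : prime p ->
  i.+1%:R * sigma pi0 i.+1 = pi0 * sigma pi0 i -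
    p%:R * pi0 * (if (i.+1 < p)%N then 0 else sigma pi0 (i.+1 - p)) :> C.
Proof.
move=> hp; rewrite mulr_natl.
set q : {poly C} := pi0 *: 'X - pi0 *: 'X^p.
pose P N : {poly C} := \sum_(0 <= n < N.+1) n`!%:R^-1 *: q ^+ n.
have dq : q^`() = pi0%:P - (p%:R * pi0) *: 'X^(p.-1).
  rewrite /q derivB !derivZ derivX derivXn alg_polyC; congr (_ - _).
  by rewrite -scaler_nat scalerA mulrC.
(* Differentiation shortens the truncated exponential by one term, which [sigma_coef] absorbs. *)
have dP N : (P N.+1)^`() = q^`() * P N.
  rewrite /P linear_sum big_nat_recl//= expr0 derivZ derivC scaler0 add0r.
  rewrite mulr_sumr; apply: eq_bigr => n _.
  rewrite derivZ deriv_exp/= -scaler_nat scalerA factS natrM invfM mulrAC.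
  by rewrite mulVf ?natCp_eq0// mul1r scalerAr.
rewrite -/(sigma pi0 i.+1) -(@sigma_coef pi0 i.+1 i.+1 hp (leqnn _)).
rewrite -/q -/(P _) -coef_deriv dP dq mulrBl coefB mul_polyC coefZ.
rewrite -scalerAl coefZ coefXnM /P !sigma_coef//; last exact: leq_subr.
congr (_ - _ * _); have p0 := prime_gt0 hp.
have -> : (i < p.-1)%N = (i.+1 < p)%N by rewrite -[in RHS](prednK p0).
by case: ltnP => // pi; congr (sigma _ _); lia.
Qed.

End PadicField.

(** * Geometric decay of the coefficients of sigma *)

Section SigmaDecay.
Variables (R : realType) (p : nat) (C : complex_padic R p) (pi0 : C).
Hypothesis hp : prime p.
Hypothesis hpi0 : summable_to (fun i : nat => pi0 ^+ (p ^ i)%N / p%:R ^+ i) 0.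
Hypothesis hord : ordp pi0 = ((p.-1)%:R^-1)%:E.

Local Notation "`| x |p" := (normCp x) (format "`| x |p").
Local Notation tau := (`|pi0|p).

Let p1 : (1 < p)%N := prime_gt1 hp.
Let nC : is_nonarch_absval (@normCp R p C) := @normCp_absval R p C.

Lemma pi0_neq0 : pi0 != 0.
Proof. by apply/eqP => h; move: hord; rewrite /ordp h eqxx. Qed.

Lemma norm_pi0X : tau ^+ p.-1 = p%:R^-1.
Proof.
have t0 : 0 < tau by rewrite (absval_gt0 nC) ?pi0_neq0.
have lp : 0 < ln (p%:R : R) by rewrite ln_gt0// ltr1n.
have p10 : (p.-1)%:R != 0 :> R by rewrite pnatr_eq0; lia.
move: hord; rewrite /ordp (negbTE pi0_neq0) => -[h].
have {}h : ln tau *+ p.-1 = - ln (p%:R : R).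
  have : - ln tau = (p.-1)%:R^-1 * ln (p%:R : R) by rewrite -h mulfVK ?gt_eqF.
  move=> /(congr1 (fun x => - (x * (p.-1)%:R))).
  by rewrite mulNr opprK -[ln tau *+ _]mulr_natr => ->; rewrite mulrAC mulVf// mul1r.
apply: ln_inj; rewrite ?posrE ?exprn_gt0 ?invr_gt0 ?ltr0n ?(ltnW p1)//.
by rewrite lnXn// h lnV// posrE ltr0n ltnW.
Qed.

Lemma norm_pi0_lt1 : tau < 1.
Proof.
have : tau ^+ p.-1 < 1 by rewrite norm_pi0X invf_lt1 ?ltr0n ?ltr1n// ltnW.
by apply: contraTT; rewrite -!leNgt; apply: exprn_ege1.
Qed.

Let tau0 : 0 < tau. Proof. by rewrite (absval_gt0 nC) ?pi0_neq0. Qed.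
Let pinv0 : 0 < p%:R^-1 :> R. Proof. by rewrite invr_gt0 ltr0n ltnW. Qed.
Let pinv1 : p%:R^-1 < 1 :> R. Proof. by rewrite invf_lt1 ?ltr0n ?ltr1n// ltnW. Qed.

Lemma normCp_p : `|p%:R : C|p = p%:R^-1.
Proof. by rewrite normCp_nat ?prime_gt0// logn_prime// eqxx expr1. Qed.

Lemma normCp_dvd n : (p %| n)%N -> `|n%:R : C|p <= p%:R^-1.
Proof.
move=> /dvdnP[m ->]; rewrite natrM (absvalM nC) normCp_p.
by rewrite ler_piMl ?(ltW pinv0)// (absval_nat_le1 nC).
Qed.

(** From p ^ i = 1 + (p - 1) S with S = 1 + p + ... + p ^ (i - 1), the norm is tau p ^ (i - S), and
    S >= i + 1 once i >= 2. *)
Lemma norm_pi0_term i : (1 < i)%N -> `|pi0 ^+ (p ^ i)%N / p%:R ^+ i|p <= tau / p%:R.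
Proof.
move=> i1; rewrite (absvalM nC) (absvalV nC) !(absvalX nC) normCp_p exprVn invrK.
have pi : (0 < p ^ i)%N by rewrite expn_gt0 ltnW.
rewrite -(prednK pi) exprS predn_exp exprM norm_pi0X -mulrA ler_pM2l//.
rewrite -ler_pdivlMr ?exprn_gt0 ?ltr0n ?(ltnW p1)// -exprVn -exprS.
rewrite ler_wiXn2l ?(ltW pinv0) ?(ltW pinv1)//.
elim: i i1 { pi } => // -[|[|i]] IHi _ //.
  by rewrite !big_ord_recr big_ord0/= expn0 expn1; lia.
have pi : (0 < p ^ i.+2)%N by rewrite expn_gt0 ltnW.
by rewrite big_ord_recr/= -[i.+4]addn1; apply: leq_add pi; apply: IHi.
Qed.

(* [pi0 ^ (p - 1) = - p (1 + O(p))]: in the defining equation of [pi0] the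
   terms of index [i >= 2] are smaller than the first two. *)
Lemma norm_pi0_defect : `|1 + pi0 ^+ p.-1 / p%:R|p <= p%:R^-1.
Proof.
have t0 : 0 < tau / p%:R by rewrite divr_gt0// ltr0n ltnW.
have /(is_limitP nC)/(_ _ t0)[M hM] := hpi0.
have := hM M.+2 (leqW (leqW (leqnn M))); rewrite subr0 /partial_sums => /ltW S0.
rewrite -(ler_pM2l tau0) -(absvalM nC) mulrDr mulr1 mulrA -exprS prednK ?prime_gt0//.
rewrite (_ : _ + _ = \sum_(0 <= i < M.+2) pi0 ^+ (p ^ i)%N / p%:R ^+ i -
                     \sum_(2 <= i < M.+2) pi0 ^+ (p ^ i)%N / p%:R ^+ i); last first.
  rewrite big_ltn// big_ltn// expn0 expn1 !expr0 !expr1 divr1 addrA.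
  by rewrite addrK.
apply: (absvalB_le nC) => //; apply: (absval_sum_le nC); first exact: ltW.
by move=> i /andP[i1 _]; apply: norm_pi0_term.
Qed.

(* [n! sigma_n / pi0 ^ n]; for [pi0 ^ (p - 1) = - p] this is the number of
   permutations of [n] points whose [p]-th power is the identity. *)
Definition sigma_fact n : C := n`!%:R * sigma pi0 n / pi0 ^+ n.

(** The correction for pi0 ^ (p - 1) not being exactly - p: a unit congruent to 1 modulo p. *)
Let w : C := - p%:R / pi0 ^+ p.-1.

Let norm_w : `|w|p = 1.
Proof.
rewrite /w (absvalM nC) (absvalN nC) (absvalV nC) (absvalX nC) norm_pi0X normCp_p.
by rewrite invrK mulVf// pnatr_eq0 gtn_eqF// ltnW.
Qed.

Let norm_wM x : `|w * x|p = `|x|p.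
Proof. by rewrite (absvalM nC w) norm_w mul1r. Qed.

Let norm_wB1 : `|w - 1|p <= p%:R^-1.
Proof.
have -> : w - 1 = w * (1 + pi0 ^+ p.-1 / p%:R).
  have pC : p%:R != 0 :> C by rewrite natCp_eq0 gtn_eqF// ltnW.
  by rewrite /w; field; rewrite pC expf_neq0 ?pi0_neq0.
by rewrite norm_wM norm_pi0_defect.
Qed.

Lemma sigma_fact_rec n :
  sigma_fact n.+1 = sigma_fact n + w * (n ^_ p.-1)%:R * sigma_fact (n.+1 - p).
Proof.
have pn m : pi0 ^+ m != 0 by rewrite expf_neq0 ?pi0_neq0.
rewrite /sigma_fact factS mulnC natrM -(mulrA n`!%:R) sigma_rec// mulrBr mulrBl.
congr (_ + _); first by rewrite exprS; field; rewrite pi0_neq0 pn.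
have [np|pn1] := ltnP n.+1 p.
  (* Here n.+1 - p is truncated to 0, but the falling factorial vanishes. *)
  by rewrite !mulr0 mul0r oppr0 ffact_small ?mulr0 ?mul0r//; lia.
have pn' : (p.-1 <= n)%N by rewrite -ltnS prednK// ltnW.
rewrite -(@ffact_fact n p.-1)// natrM.
have -> : (n - p.-1)%N = (n.+1 - p)%N by lia.
have -> : pi0 ^+ n.+1 = pi0 ^+ (n.+1 - p) * pi0 ^+ p.-1 * pi0.
  by rewrite -!exprD -exprSr; congr (_ ^+ _); lia.
by rewrite /w; field; rewrite pi0_neq0 !pn.
Qed.

Lemma sigma_fact_le1 n : `|sigma_fact n|p <= 1.
Proof.
elim/ltn_ind: n => -[|n] IHn.
  by rewrite /sigma_fact sigma0 fact0 mulr1 divr1 (absval1 nC).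
rewrite sigma_fact_rec; apply: (absvalD_le nC); first exact: IHn.
rewrite -mulrA norm_wM (absvalM nC) mulr_ile1 ?(absval_ge0 nC)//.
  exact: absval_nat_le1 nC _.
by apply: IHn; lia.
Qed.

(** The p - 1 factors n, n - 1, ..., n - p + 2 miss only the residue class of n + 1. *)
Lemma dvdn_ffact_pred n : ~~ (p %| n.+1)%N -> (p %| n ^_ p.-1)%N.
Proof.
move=> pn; have np := ltn_pmod n (ltnW p1).
have rp : (n %% p < p.-1)%N.
  rewrite ltn_neqAle -ltnS prednK ?(ltnW p1)// np andbT; apply: contra pn => /eqP h.
  by rewrite (divn_eq n p) h -addnS prednK ?(ltnW p1)// dvdn_addr ?dvdn_mull.
rewrite ffact_prod (bigD1 (Ordinal rp))//= dvdn_mulr//.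
by rewrite {1}(divn_eq n p) addnK dvdn_mull.
Qed.

(** The factors run through all nonzero residues modulo p, so Wilson's theorem gives - 1. *)
Lemma dvdn_ffact_predS k : (p %| ((p * k + p.-1) ^_ p.-1).+1)%N.
Proof.
suff E : (((p * k + p.-1) ^_ p.-1) = (p.-1)`! %[mod p])%N.
  by rewrite /dvdn -addn1 -modnDml E modnDml addn1; move: hp; rewrite (Wilson p1).
rewrite -[in RHS]ffactnn !ffact_prod.
apply: (big_ind2 (fun x y => x = y %[mod p])%N) => [//|a b c d ab cd|i _].
  by rewrite -modnMm ab cd modnMm.
by rewrite -addnBA 1?ltnW// (mulnC p k) modnMDl.
Qed.

Lemma sigma_fact_step n B : 0 <= B ->
    ~~ (p %| n.+1)%N -> `|sigma_fact (n.+1 - p)|p <= B ->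
  `|sigma_fact n.+1 - sigma_fact n|p <= p%:R^-1 * B.
Proof.
move=> B0 pn nB; rewrite sigma_fact_rec addrAC subrr add0r -mulrA norm_wM (absvalM nC).
by rewrite ler_pM ?(absval_ge0 nC)// normCp_dvd// dvdn_ffact_pred.
Qed.

(** At a multiple of p the recurrence coefficient is - 1 modulo p, so the new term is the last minus
    the first term of the block before it. *)
Lemma sigma_fact_stepM k B : 0 <= B -> `|sigma_fact (p * k)|p <= B ->
  `|sigma_fact (p * k.+1) - (sigma_fact (p * k + p.-1) - sigma_fact (p * k))|p
     <= p%:R^-1 * B.
Proof.
move=> B0 kB; have -> : (p * k.+1 = (p * k + p.-1).+1)%N by nia.
rewrite sigma_fact_rec.
have -> : ((p * k + p.-1).+1 - p = p * k)%N by nia.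
set f := _ ^_ _; set x := sigma_fact (p * k).
(* Both w - 1 and f + 1 have norm at most 1 / p. *)
have -> : sigma_fact (p * k + p.-1) + w * f%:R * x -
    (sigma_fact (p * k + p.-1) - x) = ((w - 1) * f%:R + f.+1%:R) * x.
  by rewrite -natr1; ring.
rewrite (absvalM nC) ler_pM ?(absval_ge0 nC)//.
apply: (absvalD_le nC); last by rewrite normCp_dvd// dvdn_ffact_predS.
rewrite (absvalM nC) -[leRHS]mulr1 ler_pM ?(absval_ge0 nC) ?norm_wB1//.
exact: absval_nat_le1 nC _.
Qed.

(* Modulo [p] the recurrence is constant on each block [pk, ..., pk + p - 1] and
   vanishes at the next multiple of [p], so two blocks gain a factor [p]. *)
Lemma sigma_fact_decay j n : (2 * p * j <= n)%N -> `|sigma_fact n|p <= p%:R^-1 ^+ j.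
Proof.
have p0 := ltnW p1.
elim: j n => [|j IHj] n; first by rewrite expr0 sigma_fact_le1.
set B : R := p%:R^-1 ^+ j in IHj *; rewrite exprS -/B.
have B0 : 0 <= B by rewrite exprn_ge0 // ltW.
(* The spare block in 2 j + 1 keeps the delayed index of the recurrence above 2 p j, where [IHj]
   applies. *)
have block k s : (2 * j + 1 <= k)%N -> (s < p)%N ->
    `|sigma_fact (p * k + s) - sigma_fact (p * k)|p <= p%:R^-1 * B.
  move=> kj; elim: s => [|s IHs] sp.
    by rewrite addn0 subrr (absval0 nC) mulr_ge0 // ltW.
  rewrite addnS -[X in X - _](subrK (sigma_fact (p * k + s))) -addrA.
  apply: (absvalD_le nC); last by apply: IHs; exact: ltnW.
  apply: sigma_fact_step => //; last by apply: IHj; nia.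
  by rewrite -addnS dvdn_addr ?dvdn_mulr//; apply/negP => /dvdn_leq; lia.
have mult k : (2 * j + 1 <= k)%N -> `|sigma_fact (p * k.+1)|p <= p%:R^-1 * B.
  move=> kj; rewrite -[X in `|X|p](subrK (sigma_fact (p * k + p.-1) - sigma_fact (p * k))).
  apply: (absvalD_le nC); first by apply: sigma_fact_stepM => //; apply: IHj; nia.
  by apply: block => //; rewrite prednK.
move=> jn; rewrite (divn_eq n p) mulnC.
have : (2 * j.+1 <= n %/ p)%N by rewrite leq_divRL//; nia.
case: (n %/ p)%N => [|k] kj; first lia.
rewrite -[X in `|X|p](subrK (sigma_fact (p * k.+1))).
apply: (absvalD_le nC); first by apply: block; [lia|rewrite ltn_pmod].
by apply: mult; lia.
Qed.

Lemma norm_fact_ge n : tau ^+ n <= `|n`!%:R : C|p.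
Proof.
rewrite normCp_nat ?fact_gt0// -norm_pi0X -exprM ler_wiXn2l ?(ltW tau0)//.
  exact/ltW/norm_pi0_lt1.
exact: logn_fact_le.
Qed.

(** The factor pi0 ^ n / n! relating [sigma] to [sigma_fact] has norm at most 1. *)
Lemma sigma_decay n : `|sigma pi0 n|p <= p%:R^-1 ^+ (n %/ (2 * p)).
Proof.
have f0 : n`!%:R != 0 :> C by rewrite natCp_eq0 gtn_eqF// fact_gt0.
have -> : sigma pi0 n = sigma_fact n * (pi0 ^+ n / n`!%:R).
  by rewrite /sigma_fact; field; rewrite f0 expf_neq0 ?pi0_neq0.
rewrite (absvalM nC) -[leRHS]mulr1 ler_pM ?(absval_ge0 nC)//.
  by apply: sigma_fact_decay; rewrite mulnC leq_trunc_div.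
rewrite (absvalM nC) (absvalV nC) (absvalX nC) ler_pdivrMr ?(absval_gt0 nC)//.
by rewrite mul1r norm_fact_ge.
Qed.

Lemma sigma_geom : exists M t : R, [/\ 0 <= M, 0 <= t, t < 1 &
  forall n, `|sigma pi0 n|p <= M * t ^+ n].
Proof.
have pR : 2 <= p%:R :> R by rewrite ler_nat.
(* Bernoulli's inequality then gives t ^ (2 p) >= 1 / 2 >= 1 / p. *)
pose h : R := (4 * p%:R)^-1; pose t : R := 1 - h.
have h0 : 0 < h by rewrite invr_gt0; lra.
have h1 : h <= 2^-1 by rewrite lef_pV2 ?posrE; lra.
have t0 : 0 < t by rewrite /t; lra.
have t1 : t < 1 by rewrite /t; lra.
have bern k : 1 - k%:R * h <= t ^+ k.
  elim: k => [|k IHk]; first by rewrite mul0r subr0 expr0.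
  have := ler_wpM2l (ltW t0) IHk; rewrite exprS -natr1 => /(le_trans _); apply.
  by have := mulr_ge0 (mulr_ge0 (ler0n R k) (ltW h0)) (ltW h0); rewrite /t; lra.
have tp : p%:R^-1 <= t ^+ (2 * p).
  apply: le_trans (bern _); rewrite natrM (_ : _ * h = 2^-1).
    by rewrite (_ : 1 - 2^-1 = 2^-1); [rewrite lef_pV2 ?posrE; lra|lra].
  by rewrite /h; field; lra.
(* The constant pays for the rounding in n %/ (2 * p). *)
exists (t ^- (2 * p)), t; split; rewrite ?invr_ge0 ?exprn_ge0 ?(ltW t0)// => n.
apply: le_trans (sigma_decay n) _.
rewrite ler_pdivlMl ?exprn_gt0//.
apply: (@le_trans _ _ (t ^+ (2 * p) * (t ^+ (2 * p)) ^+ (n %/ (2 * p)))).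
  by rewrite ler_wpM2l ?exprn_ge0 ?(ltW t0)// lerXn2r ?nnegrE ?exprn_ge0 ?(ltW t0)// ltW.
rewrite -exprS -exprM ler_wiXn2l ?(ltW t0) ?(ltW t1)//.
by rewrite mulnC ltnW// ltn_ceil// muln_gt0/= ltnW.
Qed.

End SigmaDecay.

(** * The series xi and their image under alpha *)

Section FormalSeries.
Variables (R : realType) (p : nat) (C : complex_padic R p) (pi0 : C).
Hypothesis hp : prime p.
Hypothesis hpi0 : summable_to (fun i : nat => pi0 ^+ (p ^ i)%N / p%:R ^+ i) 0.
Hypothesis hord : ordp pi0 = ((p.-1)%:R^-1)%:E.
Variables (d : nat) (rho : C).
Hypothesis hd : (0 < d)%N.
Hypothesis hrho : rho ^+ d = pi0.

Local Notation "`| x |p" := (normCp x) (format "`| x |p").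
Local Notation tau := (`|pi0|p).

Let p1 : (1 < p)%N := prime_gt1 hp.
Let p0 : (0 < p)%N := prime_gt0 hp.
Let nC : is_nonarch_absval (@normCp R p C) := @normCp_absval R p C.
Let pi0n : pi0 != 0 := pi0_neq0 hord.
Let tau0 : 0 < tau. Proof. exact: absval_gt0 nC _ pi0n. Qed.
Let pinv0 : 0 < p%:R^-1 :> R. Proof. by rewrite invr_gt0 ltr0n. Qed.
Let pinv1 : p%:R^-1 < 1 :> R. Proof. by rewrite invf_lt1 ?ltr0n ?ltr1n. Qed.

Lemma rho_neq0 : rho != 0.
Proof. by apply: contra pi0n => /eqP h; rewrite -hrho h expr0n gtn_eqF. Qed.

Lemma ratpowD r s : d%:R * r \is a Num.int -> d%:R * s \is a Num.int ->
  ratpow d rho (r + s) = ratpow d rho r * ratpow d rho s.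
Proof.
move=> dr ds; rewrite /ratpow -exprzDr ?unitfE ?rho_neq0//; congr (_ ^ _).
by apply: (@intr_inj rat); rewrite rmorphD/= !numqK ?mulrDr ?rpredD.
Qed.

Lemma ratpow_int z : ratpow d rho z%:~R = pi0 ^ z.
Proof.
rewrite /ratpow -[d%:R]/(d%:~R) -intrM numq_int -exprz_exp.
by rewrite -hrho.
Qed.

Lemma ratpow_neq0 r : ratpow d rho r != 0.
Proof. by rewrite expfz_neq0 ?rho_neq0. Qed.

Lemma ratpow_shift r z : d%:R * r \is a Num.int ->
  ratpow d rho (r + z%:~R) = ratpow d rho r * pi0 ^ z.
Proof.
move=> dr; rewrite ratpowD ?ratpow_int//.
by rewrite rpredM ?rpred_nat ?rpred_int.
Qed.

Lemma bracketN (z : C) n : bracket z (- n%:Z) = \prod_(0 <= i < n) (z - i%:R).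
Proof. by case: n => [|n] //=; rewrite !big_geq ?invr1. Qed.

(** For l > 0 the factor z + l cancels the last one of the denominator, hence must not vanish; for l
    <= 0 it is the next factor of the numerator. *)
Lemma bracket_rec (z : C) l : (l <= 0) || (z + l%:~R != 0) ->
  (z + l%:~R) * bracket z l = bracket z (l - 1).
Proof.
case: (intP l) => [_|n|n _].
- by rewrite addr0 sub0r (bracketN _ 1) big_nat1 subr0 /= big_geq// invr1 mulr1.
- move=> zn; rewrite (_ : n.+1%:Z - 1 = n%:Z) /=; last by lia.
  by rewrite big_nat_recr//= invfM mulrC mulfVK.
- have -> : - n.+1%:Z - 1 = - n.+2%:Z by lia.
  by rewrite !bracketN [in RHS]big_nat_recr//= mulrC rmorphN.
Qed.

Lemma bracketN1 l : 0 < l -> bracket (- 1 : C) l = 0.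
Proof.
by case: l => [[|n]|n] // _; rewrite /= big_ltn// addNr mul0r invr0.
Qed.

(* With the convention [0^-1 = 0] the case [v = -1] follows the general rule. *)
Lemma xiE v : xi d rho v =
  tshift v (fun l : int => bracket (ratr v) l * ratpow d rho (v + l%:~R)).
Proof.
rewrite /xi; case: eqP => // ->; congr tshift; apply/funext => l.
rewrite ratr_CpN (ratr_Cp_nat C 1).
have [l0|l0] := leP l 0; last by rewrite bracketN1 ?mul0r.
congr (_ * _); case: (intP l) l0 => [|n|n] // _.
  by rewrite (bracketN _ 0) big_geq// expr0 fact0 mul1r.
rewrite bracketN abszN absz_nat.
elim: (n.+1) => [|k IHk]; first by rewrite big_geq// expr0 fact0 mul1r.
by rewrite big_nat_recr//= -IHk factS natrM exprS -natr1; ring.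
Qed.

Lemma tshift_int v (c : int -> C) l : tshift v c (v + l%:~R) = c l.
Proof. by rewrite /tshift addrC addKr rpred_int numq_int. Qed.

Lemma tshift_nint v (c : int -> C) r : r - v \isn't a Num.int -> tshift v c r = 0.
Proof. by rewrite /tshift => /negbTE ->. Qed.

Lemma rat_intP (r v : rat) : r - v \is a Num.int -> exists l : int, r = v + l%:~R.
Proof. by move=> /numqK h; exists (numq (r - v)); rewrite h addrC subrK. Qed.

Variable v : rat.
Hypothesis hv : -1 <= v <= 0.
Hypothesis hdv : d%:R * v \is a Num.int.

(** Coefficientwise form of t d/dt xi = pi0 t xi. For v = -1 the exponent r = 0 is excluded: there
    the left side is 0 while the coefficient of t ^ (-1) is not. *)
Lemma xi_rec r : (v != -1) || (r != 0) ->
  ratr r * xi d rho v r = pi0 * xi d rho v (r - 1).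
Proof.
move=> vr; rewrite xiE; case: (boolP (r - v \is a Num.int)) => [/rat_intP[l rE]|rv].
  rewrite rE -addrA -(rmorphB _ l 1) !tshift_int !ratpow_shift//.
  rewrite exprzDr ?unitfE// exprN1.
  suff <- : (ratr v + l%:~R) * bracket (ratr v) l = bracket (ratr v : C) (l - 1).
    rewrite ratr_CpD (_ : ratr l%:~R = l%:~R :> C); last by rewrite ratr_Cp rmorph_int.
    by field.
  apply: bracket_rec; have [//|l0] := leP l 0.
  rewrite (_ : _ + _ = ratr r); last by rewrite rE ratr_CpD [ratr l%:~R]ratr_Cp rmorph_int.
  rewrite ratr_Cp_eq0; case/orP: vr => // vN1; rewrite rE gt_eqF//.
  have : 1 <= l%:~R :> rat by rewrite (ler_int _ 1).
  by move: hv vN1; rewrite le_eqVlt eq_sym => /andP[/predU1P[->|] ]; rewrite ?eqxx//; lra.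
rewrite !tshift_nint ?mulr0//; apply: contra rv => rv.
by rewrite -[r](subrK 1) addrAC rpredD.
Qed.

(** * Polynomial growth of the coefficients of xi *)

Hypothesis hvp : padic_integral p v.

(** Thus v = - a / b with 0 <= a <= b, and b is a p-adic unit. *)
Let a := `|numq v|%N.
Let b := `|denq v|%N.

Let b0 : (0 < b)%N. Proof. by rewrite absz_gt0 denq_neq0. Qed.

Let vE : v = - a%:R / b%:R.
Proof.
have nv : numq v <= 0 by rewrite numq_le0; case/andP: hv.
rewrite -{1}(divq_num_den v) /a /b; congr (_ / _).
  by rewrite natr_absz ler0_norm// rmorphN opprK.
by rewrite natr_absz gtr0_norm.
Qed.

Let ab : (a <= b)%N.
Proof.
have bR : 0 < b%:R :> rat by rewrite ltr0n.
by case/andP: hv; rewrite vE ler_pdivlMr// mulN1r lerN2 ler_nat.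
Qed.

Let cpb : coprime p b. Proof. by rewrite prime_coprime. Qed.

Let ratr_v : ratr v = - a%:R / b%:R :> C.
Proof. by rewrite vE ratr_Cp rmorphM fmorphV rmorphN !rmorph_nat. Qed.

Let bC : b%:R != 0 :> C. Proof. by rewrite natCp_eq0 gtn_eqF. Qed.

Let norm_b : `|b%:R : C|p = 1.
Proof. by rewrite normCp_nat// logn_coprime. Qed.

Lemma norm_bracketN n : `|bracket (ratr v : C) (- n%:Z)|p = `|(arith_prod a b n)%:R : C|p.
Proof.
rewrite bracketN /arith_prod -(big_mkord xpredT (fun i => a + b * i)%N).
rewrite natr_prod !(absval_prod nC); apply: eq_bigr => i _.
rewrite ratr_v (_ : _ - _ = - ((a + b * i)%:R / b%:R)); last first.
  by rewrite natrD natrM; field.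
by rewrite (absvalN nC) (absvalM nC) (absvalV nC) norm_b invr1 mulr1.
Qed.

Lemma norm_bracketP n :
  `|bracket (ratr v : C) n%:Z|p = `|(arith_prod (b - a) b n)%:R : C|p^-1.
Proof.
rewrite [bracket _ _]/= (absvalV nC) big_add1/=; congr (_^-1).
rewrite /arith_prod -(big_mkord xpredT (fun i => (b - a) + b * i)%N).
rewrite natr_prod !(absval_prod nC); apply: eq_bigr => i _.
rewrite ratr_v (_ : _ + _ = ((b - a) + b * i)%:R / b%:R).
  by rewrite (absvalM nC) (absvalV nC) norm_b invr1 mulr1.
by rewrite natrD natrB// natrM -[i.+1%:R]natr1; field.
Qed.

(** The digit count T of [logn_fact_ge] costs a factor p ^ T, which is linear in n. *)
Lemma fact_pinv_le n : p%:R^-1 ^+ logn p n`! <= tau ^+ n * (p * n.+1)%:R.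
Proof.
have [T pT nT] := logn_fact_ge n hp.
have : tau ^+ (p.-1 * (logn p n`! + T)) <= tau ^+ n.
  by rewrite ler_wiXn2l ?(ltW tau0) ?ltW ?(norm_pi0_lt1 hp hord).
rewrite exprM (norm_pi0X hp hord) exprD => h.
have pT0 : 0 < (p ^ T)%:R :> R by rewrite ltr0n expn_gt0 p0.
apply: (@le_trans _ _ (tau ^+ n * (p ^ T)%:R)); last first.
  by rewrite ler_wpM2l ?exprn_ge0 ?(ltW tau0)// ler_nat.
by rewrite -ler_pdivrMr// natrX -exprVn.
Qed.

Lemma norm_bracketN_le n :
  `|bracket (ratr v : C) (- n%:Z) * pi0 ^ (- n%:Z)|p <= (p * n.+1)%:R.
Proof.
rewrite (absvalM nC) norm_bracketN -exprnN (absvalV nC) (absvalX nC).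
rewrite ler_pdivrMr ?exprn_gt0// mulrC; apply: le_trans (fact_pinv_le n).
have /dvdnP[k ->] := fact_dvd_arith_prod a n hp cpb.
rewrite natrM natrX (absvalM nC) (absvalX nC) (normCp_p _ hp).
by rewrite ler_piMl ?exprn_ge0 ?(ltW pinv0)// (absval_nat_le1 nC).
Qed.

Lemma norm_bracketP_le n :
  `|bracket (ratr v : C) n%:Z * pi0 ^ n%:Z|p <= (p * n.+1)%:R ^+ b.-1.
Proof.
rewrite (absvalM nC) norm_bracketP -exprnP (absvalX nC) mulrC.
(* The case a = b is v = -1: for n > 0 the denominator is 0 and so is its inverse by convention. *)
have [bea|bna] := eqVneq b a.
  case: n => [|n].
    rewrite /arith_prod big_ord0 expr0 (absval1 nC) mul1r invr1 exprn_ege1//.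
    by rewrite muln1 ler1n.
  rewrite /arith_prod big_ord_recl/= bea subnn muln0 add0n mul0n.
  by rewrite (absval0 nC) invr0 mulr0 exprn_ge0.
have abl : (0 < b - a <= b)%N by rewrite subn_gt0 ltn_neqAle eq_sym bna ab leq_subr.
have Q0 := arith_prod_gt0 b n (proj1 (andP abl)).
have LQ := logn_arith_prod_le n hp abl cpb; have Lf := logn_fact_le (b * n) hp.
have [T pT nT] := logn_fact_ge n hp.
rewrite normCp_nat// ler_pdivrMr ?exprn_gt0//.
(* With x, y, z the valuations of the product, n! and (b n)!: x + (b - 1) y <= z, (p - 1) z <= b n
   and n <= (p - 1) (y + T). *)
have exp_le : (p.-1 * logn p (arith_prod (b - a) b n) <= n + p.-1 * (T * b.-1))%N.
  move: LQ Lf nT; set x := logn p (arith_prod _ _ _); set y := logn p n`!.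
  set z := logn p (b * n)`!; rewrite -(prednK b0) /=; move: (b.-1) (p.-1) => B P; nia.
have : tau ^+ (n + p.-1 * (T * b.-1)) <= tau ^+ (p.-1 * logn p (arith_prod (b - a) b n)).
  by rewrite ler_wiXn2l ?(ltW tau0) ?ltW ?(norm_pi0_lt1 hp hord).
rewrite exprD !(exprM tau p.-1) (norm_pi0X hp hord) => h.
have pT0 : 0 < p%:R ^+ (T * b.-1) :> R by rewrite exprn_gt0 ?ltr0n.
apply: (@le_trans _ _ (p%:R ^+ (T * b.-1) * p%:R^-1 ^+ logn p (arith_prod (b - a) b n))).
  by rewrite mulrC -ler_pdivrMr// -exprVn.
rewrite ler_wpM2r ?exprn_ge0 ?(ltW pinv0)// exprM lerXn2r ?nnegrE ?exprn_ge0//.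
by rewrite -natrX ler_nat.
Qed.

Lemma norm_xi_coef_le : exists2 K : R, 0 <= K & forall l : int,
  `|bracket (ratr v) l * ratpow d rho (v + l%:~R)|p <= K * (`|l|%N.+1)%:R ^+ b.
Proof.
exists (`|ratpow d rho v|p * p%:R ^+ b); first by rewrite mulr_ge0 ?(absval_ge0 nC)// exprn_ge0.
move=> l; rewrite ratpow_shift// mulrCA (absvalM nC) -mulrA ler_wpM2l ?(absval_ge0 nC)//.
rewrite -exprMn -natrM.
have n1 n : 1 <= (p * n.+1)%:R :> R by rewrite ler1n muln_gt0 p0.
case: (intP l) => [|n|n]; rewrite ?abszN absz_nat.
- apply: le_trans (norm_bracketN_le 0) _; rewrite -[leLHS]expr1.
  by rewrite ler_weXn2l.
- by apply: le_trans (norm_bracketP_le _) _; rewrite ler_weXn2l// leq_pred.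
- apply: le_trans (norm_bracketN_le _) _; rewrite -[leLHS]expr1.
  by rewrite ler_weXn2l.
Qed.

Lemma xi_alpha_domain : xi d rho v \in alpha_domain C v.
Proof.
rewrite inE /alpha_domain xiE.
set c := (X in tshift v X).
have [K K0 hK] := norm_xi_coef_le.
have cB : Cbrace c.
  move=> delta d0 d1; split; apply: (@cvg0_le_poly_geom _ _ K delta b) => //.
  - exact: ltW.
  - by move=> n; rewrite mulr_ge0 ?(absval_ge0 nC)// exprn_ge0 ?ltW.
  - by move=> n; rewrite mulrA ler_wpM2r ?exprn_ge0 ?(ltW d0)//; apply: hK n%:Z.
  - exact: ltW.
  - by move=> n; rewrite mulr_ge0 ?(absval_ge0 nC)// exprn_ge0 ?ltW.
  - move=> n; rewrite mulrA ler_wpM2r ?exprn_ge0 ?(ltW d0)//.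
    by have := hK (- n%:Z); rewrite abszN.
case: eqP => [vN1|_]; exists c => //; split=> // l l0.
by rewrite /c vN1 ratr_CpN (ratr_Cp_nat C 1) bracketN1 ?mul0r.
Qed.

(** * The product of sigma(t) and xi(t ^ p) *)

Lemma mul_sigma_converges r : series_converges (mul_sigma_term pi0 (Phi (xi d rho v)) r).
Proof.
have [K K0 hK] := norm_xi_coef_le.
have [M [t [M0 t0 t1 ht]]] := sigma_geom hp hpi0 hord.
(* The index l of the coefficient met at step i satisfies |l| <= |r| + i + |v| <= A + i. *)
pose A := (Num.bound `|r|).+1.
have fB i : `|Phi (xi d rho v) (r - i%:R)|p <= K * (A.+1%:R * i.+1%:R) ^+ b.
  rewrite /Phi xiE; set s := (r - i%:R) / p%:R.
  case: (boolP (s - v \is a Num.int)) => [/rat_intP[l sE]|sv]; last first.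
    by rewrite tshift_nint// (absval0 nC) mulr_ge0// exprn_ge0 ?mulr_ge0.
  rewrite sE tshift_int; apply: le_trans (hK l) _.
  rewrite ler_wpM2l// lerXn2r ?nnegrE ?mulr_ge0// -natrM ler_nat.
  suff : (`|l| <= A + i)%N.
    move/leq_trans => lA; rewrite mulSn mulnS addSn ltnS addnA (addnC i) lA//.
    exact: leq_addr.
  rewrite -(ler_nat rat) natr_absz natrD intr_norm.
  have -> : l%:~R = s - v by rewrite sE addrC addKr.
  have sN : `|s| <= `|r| + i%:R.
    rewrite /s normrM normfV (ger0_norm (ler0n _ p)) ler_pdivrMr ?ltr0n//.
    have := ler_normB r i%:R; rewrite (ger0_norm (ler0n _ i)).
    by move/le_trans; apply; rewrite ler_peMr ?ler1n ?addr_ge0.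
  have := ler_normB s v; have rA := archi_boundP (normr_ge0 r).
  have : `|v| <= 1 by rewrite ler_norml; move: hv; lra.
  by rewrite /A -natr1; lra.
apply: null_series_converges; rewrite /is_limit.
apply: (@cvg0_le_poly_geom _ _ (M * K * A.+1%:R ^+ b) t b) => // i.
  exact: absval_ge0.
rewrite subr0 /mul_sigma_term (absvalM nC).
apply: le_trans (ler_pM (absval_ge0 nC _) (absval_ge0 nC _) (ht i) (fB i)) _.
by rewrite exprMn le_eqVlt; apply/orP; left; apply/eqP; ring.
Qed.

(** The product rule for t d/dt, read on the coefficient of t ^ r by splitting r as i + (r - i) in
    the i-th term. *)
Lemma mul_sigma_rec r : (forall i : nat, (v != -1) || (r - i%:R != 0)) ->
  ratr r * mul_sigma pi0 (Phi (xi d rho v)) r =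
  pi0 * mul_sigma pi0 (Phi (xi d rho v)) (r - 1).
Proof.
move=> vr; pose f := Phi (xi d rho v).
pose T r := mul_sigma_term pi0 f r; pose g := mul_sigma pi0 f.
rewrite -/f -/g.
have T_g s : summable_to (T s) (g s) by apply/infsumP/mul_sigma_converges.
have Phi_rec i : ratr (r - i%:R) * f (r - i%:R) = p%:R * pi0 * f (r - p%:R - i%:R).
  have pR : p%:R != 0 :> rat by rewrite pnatr_eq0 gtn_eqF.
  have h : (v != -1) || ((r - i%:R) / p%:R != 0).
    by rewrite mulf_eq0 invr_eq0 (negbTE pR) orbF vr.
  have E : ratr (r - i%:R) = p%:R * ratr ((r - i%:R) / p%:R) :> C.
    by rewrite -(ratr_Cp_nat C p) -ratr_CpM mulrC divfK.
  rewrite E -mulrA /f /Phi (xi_rec h) mulrA; congr (_ * xi d rho v _).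
  by field.
have lhs := summableZ (ratr r) (T_g r).
(* The first two series come from t d/dt sigma, the third from t d/dt xi(t ^ p); the terms in p pi0
   t ^ p cancel in the sum. *)
have rhs := summableD (summableD (summableZ pi0 (summable_shift 1 (T_g (r - 1))))
  (summableZ (- (p%:R * pi0)) (summable_shift p (T_g (r - p%:R)))))
  (summableZ (p%:R * pi0) (T_g (r - p%:R))).
rewrite mulNr subrK in rhs; rewrite -(summable_infsum rhs) -(summable_infsum lhs).
congr infsum; apply/funext => i.
have -> : ratr r * T r i =
    i%:R * sigma pi0 i * f (r - i%:R) + sigma pi0 i * (ratr (r - i%:R) * f (r - i%:R)).
  rewrite /T /mul_sigma_term -{1}[r](subrK i%:R) ratr_CpD (ratr_Cp_nat C i).
  by ring.
rewrite Phi_rec [X in _ = _ + X](_ : _ = sigma pi0 i * (p%:R * pi0 * f (r - p%:R - i%:R))); last first.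
  by rewrite /T /mul_sigma_term; ring.
congr (_ + _).
have shift k : (k <= i)%N -> T (r - k%:R) (i - k)%N = sigma pi0 (i - k) * f (r - i%:R).
  by move=> ki; rewrite /T /mul_sigma_term natrB// opprB addrA subrK.
case: i {Phi_rec} shift => [|i] shift; first by rewrite !mul0r p0 !mulr0 addr0.
rewrite (sigma_rec pi0 i hp) /= (shift 1%N)// subn1 /=.
case: ltnP => [_|pi]; first by rewrite !mulr0 subr0 addr0 mulrA.
by rewrite shift//; ring.
Qed.

Lemma mul_sigma_supp r : r - p%:R * v \isn't a Num.int ->
  mul_sigma pi0 (Phi (xi d rho v)) r = 0.
Proof.
move=> rv; apply: summable_infsum; apply: summable0 => i.
rewrite /mul_sigma_term /Phi xiE tshift_nint ?mulr0//; apply: contra rv => h.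
have -> : r - p%:R * v = p%:R * ((r - i%:R) / p%:R - v) + i%:R.
  by field; rewrite pnatr_eq0 gtn_eqF.
by rewrite rpredD ?rpredM ?rpred_nat.
Qed.

(** In the coefficient of t ^ (p v) only the indices i = p l survive; they meet the coefficient of t
    ^ (v - l) in xi, and [[v]_(-l)] is (-1) ^ l (- v)_l. *)
Lemma Hterm_summable : summable_to (Hterm pi0 (- ratr v : C))
  (mul_sigma pi0 (Phi (xi d rho v)) (p%:R * v) / ratpow d rho v).
Proof.
have pR : p%:R != 0 :> rat by rewrite pnatr_eq0 gtn_eqF.
have arg i : (p%:R * v - i%:R) / p%:R = v - i%:R / p%:R by field.
have supp i : ~~ (p %| i)%N -> mul_sigma_term pi0 (Phi (xi d rho v)) (p%:R * v) i = 0.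
  move=> pi; rewrite /mul_sigma_term /Phi arg xiE tshift_nint ?mulr0//.
  rewrite addrAC subrr add0r rpredN; apply: contra pi => /numqK h.
  have : (i%:Z = numq (i%:R / p%:R) * p%:Z)%R.
    by apply: (@intr_inj rat); rewrite rmorphM/= h divfK.
  by move=> /(congr1 absz); rewrite abszM !absz_nat => ->; rewrite dvdn_mull.
have /infsumP/(summable_multiples p0 supp) := mul_sigma_converges (p%:R * v).
move=> /(summableZ (ratpow d rho v)^-1); rewrite [X in summable_to _ X]mulrC.
congr (summable_to _ _); apply/funext => l.
rewrite /mul_sigma_term /Phi arg natrM mulrAC divff// mul1r.
have -> : v - l%:R = v + (- l%:Z)%:~R by rewrite rmorphN.
rewrite xiE tshift_int ratpow_shift// bracketN -exprnN /Hterm /pochhammer.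
have -> : \prod_(0 <= i < l) (ratr v - i%:R) =
    (-1) ^+ l * \prod_(0 <= i < l) (- ratr v + i%:R) :> C.
  elim: (l) => [|k IHk]; first by rewrite !big_geq// expr0 mul1r.
  by rewrite !big_nat_recr//= IHk exprS; ring.
by field; rewrite ratpow_neq0 expf_neq0.
Qed.

End FormalSeries.

(** * Identification of alpha(xi) from its coefficient at t ^ (p v) *)

Lemma padic_integral_int p (v : rat) : prime p -> padic_integral p v ->
  p%:R * v \is a Num.int -> v \is a Num.int.
Proof.
move=> hp hvp /numqK h; rewrite Qint_def.
have E : (p%:Z * numq v = numq (p%:R * v) * denq v)%R.
  apply: (@intr_inj rat); rewrite !rmorphM/= h -mulrA; congr (_ * _).
  by rewrite -{2}[v]divq_num_den divfK// intr_eq0 denq_eq0.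
(* Integrality of p v leaves 1 or p as denominator, and p-integrality rules out p. *)
have dp : (`|denq v| %| p)%N.
  rewrite -(@Gauss_dvdl _ _ `|numq v|%N); last by rewrite coprime_sym coprime_num_den.
  move/(congr1 absz): E; rewrite !abszM absz_nat => ->; exact: dvdn_mull.
have /primeP[_ /(_ _ dp)/orP[/eqP d1|/eqP dE]] := hp.
  by rewrite -(gtz0_abs (denq_gt0 v)) d1.
by move: hvp; rewrite /padic_integral dE dvdnn.
Qed.

Theorem theorem7p1 (R : realType) (p : nat) (hp : prime p)
    (C : complex_padic R p) (N : nat) (v v' : 'I_N -> rat)
    (hv : forall j, -1 <= v j <= 0)
    (hvp : forall j, padic_integral p (v j))
    (hv' : forall j, -1 <= v' j <= 0)
    (hvv' : forall j, exists2 m : nat, (m < p)%N & p%:R * v j - v' j = - m%:R)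
    (pi0 : C)
    (hpi0 : summable_to (fun i : nat => pi0 ^+ (p ^ i)%N / p%:R ^+ i) 0)
    (hord : ordp pi0 = ((p.-1)%:R^-1)%:E)
    (d : nat) (hd : (0 < d)%N) (hdv : forall j, d%:R * v j \is a Num.int)
    (rho : C) (hrho : rho ^+ d = pi0) (j : 'I_N) :
  [/\ xi d rho (v j) \in alpha_domain C (v j),
      forall r : rat, series_converges (mul_sigma_term pi0 (Phi (xi d rho (v j))) r),
      series_converges (Hterm pi0 (- ratr (v j)))
    & alpha pi0 (v j) (xi d rho (v j)) =
      scale_series
        (ratpow d rho (- ((p.-1)%:R * v j))
         * (Hfun pi0 (- ratr (v j))
            / bracket (ratr (v' j)) (numq (p%:R * v j - v' j))))
        (xi d rho (v' j))].
Proof.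
have {hv}hv := hv j; have {hvp}hvp := hvp j; have {hv'}hv' := hv' j.
have {hdv}hdv := hdv j.
have [m mp pvv] := hvv' j.
move: (v j) (v' j) hv hvp hv' hdv pvv => {v v' hvv' j N} v v' hv hvp hv' hdv pvv.
have p0 := prime_gt0 hp.
have pR : 0 < p%:R :> rat by rewrite ltr0n.
have mpR : m%:R + 1 <= p%:R :> rat by rewrite natr1 ler_nat.
have m0 : 0 <= m%:R :> rat by [].
have pvE : p%:R * v = v' - m%:R by rewrite -pvv addrC subrK.
have hdv' : d%:R * v' \is a Num.int.
  have -> : d%:R * v' = p%:R * (d%:R * v) + d%:R * m%:R.
    by rewrite mulrCA pvE; ring.
  by apply: rpredD; apply: rpredM => //; apply: rpred_nat.
have pi0n := pi0_neq0 hord.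
have rp0 r : ratpow d rho r != 0 := ratpow_neq0 hord hd hrho r.
(* An integral p v leaves only the two end points, where zero factors can occur. *)
have vint : p%:R * v \is a Num.int -> v = -1 \/ v = 0.
  move=> /(padic_integral_int hp hvp)/numqK vz; move: hv; rewrite -vz.
  rewrite -(rmorphN1 intr) !(ler_int, (ler_int rat _ 0)).
  move: (numq v) => z z01; have : z = -1 \/ z = 0 by lia.
  by case=> ->; [left|right].
have v'N1 : v' = -1 -> v = -1.
  move=> v'E; case: vint => // [|v00]; first by rewrite pvE v'E rpredB ?rpred_nat ?rpredN1.
  by move: pvE; rewrite v00 v'E mulr0; lra.
have v'0 : v' = 0 -> m = 0%N.
  move=> v'E; have [||vE] := vint; first by rewrite pvE v'E rpredB ?rpred_nat.
    by move=> vE; exfalso; move: pvE; rewrite vE v'E; lra.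
  apply/eqP; rewrite -(@pnatr_eq0 rat); apply/eqP.
  by move: pvE; rewrite vE v'E mulr0; lra.
(* A factor v' - i with i < m and v' <= 0 vanishes only if v' = 0, and then m = 0. *)
have bN0 : bracket (ratr v' : C) (- m%:Z) != 0.
  rewrite bracketN big_nat prodf_seq_neq0; apply/allP => i _; apply/implyP => /andP[_ im].
  rewrite -(ratr_Cp_nat C i) -ratr_CpN -ratr_CpD ratr_Cp_eq0.
  apply/eqP => v'i; have i0 : 0 <= i%:R :> rat by [].
  have : v' = 0 by move: hv' v'i; lra.
  by move=> /v'0 mE; move: im; rewrite mE.
split; first exact: (xi_alpha_domain hp hord hd hrho hv hdv hvp).
- exact: (mul_sigma_converges hp hpi0 hord hd hrho hv hdv hvp).
- by eexists; exact: (Hterm_summable hp hpi0 hord hd hrho hv hdv hvp).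
pose g := mul_sigma pi0 (Phi (xi d rho v)).
pose c := ratpow d rho (- ((p.-1)%:R * v)) *
  (Hfun pi0 (- ratr v : C) / bracket (ratr v') (numq (p%:R * v - v'))).
(* The difference of both sides, before truncation by gamma, obeys the recurrence and is shown to
   vanish at p v. *)
pose h r := g r - c * xi d rho v' r.
rewrite -/c.
have h0 : h (p%:R * v) = 0.
  rewrite /h /c /Hfun (summable_infsum (Hterm_summable hp hpi0 hord hd hrho hv hdv hvp)).
  rewrite -/g pvv; have -> : numq (- m%:R) = - m%:Z.
    by rewrite numqN -(numq_int m).
  rewrite [in xi _ _ _ _]pvE -[m%:R]/(m%:~R) -rmorphN xiE // tshift_int.
  have -> : v' + (- m%:Z)%:~R = p%:R * v by rewrite rmorphN pvE.
  have -> : ratpow d rho v =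
      ratpow d rho (- ((p.-1)%:R * v)) * ratpow d rho (p%:R * v).
    rewrite -(ratpowD hord hd hrho).
    - by congr ratpow; rewrite -{2}(prednK p0) -[p.-1.+1%:R]natr1; ring.
    - by rewrite mulrN mulrCA rpredN rpredM ?rpred_nat.
    - by rewrite mulrCA rpredM ?rpred_nat.
  by field; rewrite bN0 !rp0.
(* For v = -1 the condition ensures that no r - i with i >= 0 is 0, so the exceptional exponent is
   never met. *)
have hrec r : (v != -1) || (r \isn't a Num.int) || (r <= -1) ->
    ratr r * h r = pi0 * h (r - 1).
  move=> vr; rewrite /h !mulrBr (mul_sigma_rec hp hpi0 hord hd hrho hv hdv hvp).
    rewrite mulrCA (xi_rec hp hord hd hrho hv' hdv') ?[pi0 * (c * _)]mulrCA//.
    have [/v'N1 vE|//] := eqVneq v' (-1); move: vr; rewrite vE eqxx/=.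
    by apply: contraTneq => ->; rewrite rpred0.
  move=> i; case: eqP vr => //= _; apply: contraTneq => /eqP; rewrite subr_eq0 => /eqP ->.
  by rewrite rpred_nat/= -ltNge (lt_le_trans (ltrN10 _)).
have gh r : (v != -1) || (r <= -1) -> g r = c * xi d rho v' r.
  move=> vr; case: (boolP (r - p%:R * v \is a Num.int)) => [/rat_intP[z rE]|rv]; last first.
    rewrite /g mul_sigma_supp// xiE// tshift_nint ?mulr0//.
    apply: contra rv => rv; rewrite pvE (_ : _ - _ = r - v' + m%:R); last by ring.
    by rewrite rpredD ?rpred_nat.
  apply/eqP; rewrite -subr_eq0 -/(h r) rE; move: vr; rewrite rE {r rE}.
  case: (intP z) => [|n|n].
  - by rewrite addr0 h0.
  - rewrite -[n.+1%:~R]/(n.+1%:R).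
    elim: (n.+1) => [|k IHk] vk; first by rewrite addr0 h0.
    have vk' : (v != -1) || (p%:R * v + k%:R <= -1).
      by case/orP: vk => [->//|vk]; apply/orP; right; rewrite -natr1 in vk; lra.
    have := hrec (p%:R * v + k.+1%:R).
    have -> : p%:R * v + k.+1%:R - 1 = p%:R * v + k%:R by rewrite -natr1; ring.
    rewrite (eqP (IHk vk')) mulr0 => /(_ _)/eqP.
    rewrite mulf_eq0 ratr_Cp_eq0.
    (* Going up divides by r. If r = 0 then p v is a negative integer, so v = -1, which is ruled out
       here. *)
    have rn0 : p%:R * v + k.+1%:R != 0.
      case/orP: vk => [vN1|vk]; last by rewrite lt_eqF// (le_lt_trans vk) ?ltrN10.
      apply: contra vN1; rewrite addr_eq0 => /eqP pvk.
      have [||vE] := vint; first by rewrite pvk rpredN rpred_nat.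
        by move=> ->.
      move: pvk; rewrite vE mulr0 => /eqP.
      by rewrite eq_sym oppr_eq0 pnatr_eq0.
    rewrite (negbTE rn0)/=; apply.
    by case/orP: vk => [->//|->]; rewrite orbT.
  (* Going down divides by [pi0]; for v = -1 the start - p is at most - 1, so the recurrence stays
     available. *)
  - have zN i : (- i%:Z)%:~R = - i%:R :> rat by rewrite mulrNz.
    move=> _; elim: (n.+1) => [|k IHk]; first by rewrite addr0 h0.
    have : pi0 * h (p%:R * v + (- k.+1%:Z)%:~R) == 0.
      rewrite (_ : _ + _ = p%:R * v + (- k%:Z)%:~R - 1); last first.
        by rewrite !zN -natr1; ring.
      rewrite -hrec ?(eqP IHk) ?mulr0//.
      have [vE|//] := eqVneq v (-1); apply/orP; right.
      have k0 : 0 <= k%:R :> rat by [].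
      have p1 : 1 <= p%:R :> rat by rewrite ler1n.
      by rewrite zN vE; lra.
    by rewrite mulf_eq0 (negbTE pi0n).
apply/funext => r; rewrite /alpha /scale_series -/g.
case: eqP => [vE|/eqP vN1]; last by rewrite gh ?vN1.
(* Above t ^ (-1) gamma leaves 0, and so does the right side: v = -1 forces v' = m - p = -1, and
   [[-1]_l] is 0 by convention for l > 0. *)
rewrite /gamma_trunc; case: ifPn => r1; first by rewrite gh // r1 orbT.
have v'E : v' = -1 by move: pvE hv'; rewrite vE; lra.
rewrite xiE // v'E; case: (boolP (r - (-1) \is a Num.int)) => [/rat_intP[z rE]|rv].
  rewrite rE tshift_int ratr_CpN (ratr_Cp_nat C 1) bracketN1 ?mul0r ?mulr0//.
  by move: r1; rewrite -ltNge rE ltrDl ltr0z.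
by rewrite tshift_nint ?mulr0.
Qed.
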